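(* Let $(X,\mathcal{S},\mu)$ be a space with a complete perfect measure and let $Y$ be a metric space. Let $F\colon X\to K^+(Y)$ be a lower $\mathcal{S}$-measurable function. Then $F$ admits a measurable selector, i.e. an $\mathcal{S}$-measurable function $f\colon X\to Y$ with $f(x)\in F(x)$ for each $x\in X$.
   Context: $(X,\mathcal{S},\mu)$ denotes a set (space) $X$ together with a $\sigma$-field $\mathcal{S}$ of subsets of $X$ and a measure $\mu$ defined on $\mathcal{S}$; all measures are $\sigma$-additive and finite. The sets in $\mathcal{S}$ are called measurable. A function $f\colon X\to Y$ into a topological space $Y$ is $\mathcal{S}$-measurable iff $f^{-1}(U)\in\mathcal{S}$ for each open $U\subset Y$. The measure $\mu$ is perfect iff for every $\mathcal{S}$-measurable function $f\colon X\to\mathbb{R}$ and every $E\subset\mathbb{R}$ with $f^{-1}(E)\in\mathcal{S}$ there exists a Borel set $B\subset E$ such that $\mu(f^{-1}(E))=\mu(f^{-1}(B))$. $K^+(Y)$ denotes the family of all non-empty compact subsets of $Y$. A map $F\colon X\to\mathcal{P}(Y)$ is lower $\mathcal{S}$-measurable (lower-$\mathcal{S}$) iff $\{x\in X\colon F(x)\cap U\neq\emptyset\}\in\mathcal{S}$ for each open $U\subset Y$. A selector for $F$ is a function $f\colon X\to Y$ such that $f(x)\in F(x)$ for each $x\in X$. *)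

(* Defs.v *)
From HB Require Import structures.
From mathcomp Require Import all_boot all_order all_algebra.
From mathcomp Require Import all_classical all_reals all_analysis.
Import Order.TTheory GRing.Theory Num.Theory.
Import numFieldNormedType.Exports.

Set Implicit Arguments.
Unset Strict Implicit.
Unset Printing Implicit Defensive.

Local Open Scope classical_set_scope.
Local Open Scope ring_scope.

(* The library's [measurable_fun] requires a sigma-algebra on the codomain;
   here the codomain only carries a topology. *)
Definition topmeasurable d (X : measurableType d) (Y : topologicalType)
    (f : X -> Y) : Prop :=
  forall U : set Y, open U -> measurable (f @^-1` U).

Definition borel_set (Y : topologicalType) : set (set Y) := <<s @open Y >>.

(* [E] ranges over arbitrary sets of reals, not only Borel ones. *)
Definition perfect_measure d (X : measurableType d) (R : realType)
    (mu : set X -> \bar R) : Prop :=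
  forall f : X -> R, topmeasurable f ->
  forall E : set R, measurable (f @^-1` E) ->
  exists B : set R,
    [/\ borel_set B, B `<=` E & mu (f @^-1` E) = mu (f @^-1` B)].

Definition lower_measurable d (X : measurableType d) (Y : topologicalType)
    (F : X -> set Y) : Prop :=
  forall U : set Y, open U -> measurable [set x | F x `&` U !=set0].

Definition selector (X Y : Type) (F : X -> set Y) (f : X -> Y) : Prop :=
  forall x, F x (f x).

(* Main.v *)
Require Import Defs.
From HB Require Import structures.
From mathcomp Require Import all_boot all_order all_algebra.
From mathcomp Require Import all_classical all_reals all_analysis.
From mathcomp Require Import measurable_realfun ring lra.
Import Order.TTheory GRing.Theory Num.Theory.
Import numFieldNormedType.Exports.

(** The space [Y] is not assumed separable, and measurable cardinals cannot be
excluded, so [F] need not have an essentially separable range.  What perfectness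
gives is a decomposition into countably many pieces on which [mu] induces a
two-valued measure.

Let [G] assign to each point of [X] a finite subset of a set [A], in such a way
that [hit G T], the set of the [x] with [G x] meeting [T], is measurable for
every subset [T] of [A].  Call [T] indivisible when of any two complementary
parts of [T] at least one is hit only on a null set: if [T] itself is not null,
its parts which are not null form a countably complete ultrafilter.  Then [A]
is, up to a set which is hit almost nowhere, a countable union of indivisible
sets ([indivisible_cover]).  Indeed [T |-> mu (hit G T)] tends to zero along
disjoint sequences, so that an exhaustion argument covers [A], for each [k], by
countably many sets which are indivisible or are hit with measure at most
[1/(k+1)].  On what the indivisible pieces leave out, a point is described by
the sequence of the numbers of the pieces containing it, hence by a real
number, and all the fibres of this coding are null.  No perfect measure allows
this unless the whole remainder is null ([real_point_not_negligible]): after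
localisation [G] becomes single-valued, i.e. a function to the reals all of
whose preimages are measurable; its distribution function makes it dominated by
Lebesgue measure, and translates of a Vitali set then show that the total mass
is zero ([perfect_measure_atom]).

In [Y], let [p y] be the first point, for some well-ordering, at distance less
than [eps] from [y].  On the set where [mdist y (p y) <= eps - r], two points
with different values of [p] are at distance at least [r].  So a compact set
meets finitely many of the fibres of [p] on this set, and the previous
paragraph applies with [A = Y].  One gets countably many closed sets which
cover almost every [F x], each of which is small relatively to [F]: for every
set [D], for almost every [x], if [F x] meets [D] inside the piece, then every
point of [F x] in the piece is within [4 * eps] of [D] ([small_closed_cover]).

The selector is then built as in the theorem of Kuratowski and Ryll-Nardzewski:
[F x] is cut down successively to the first piece that it meets, for
[eps = 1/(k+1)], and [f x] is any point of the intersection.  For [D] closed,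
[f @^-1` D] differs by a null set from the set of the [x] all of whose
successive cuts meet [D]; since [mu] is complete, it is measurable. *)

Set Implicit Arguments.
Unset Strict Implicit.
Unset Printing Implicit Defensive.

Local Open Scope classical_set_scope.
Local Open Scope ring_scope.

(** * Null sets of Vitali type *)

(** The measures of a point-finite sequence of sets tend to zero: the tails of
the sequence decrease to the empty set. *)
Lemma point_finite_small d (X : measurableType d) (R : realType)
    (mu : {measure set X -> \bar R}) (D : set X) (H : (set X)^nat) (e : R) :
  measurable D -> (mu D < +oo)%E ->
  (forall n, measurable (H n)) -> (forall n, H n `<=` D) ->
  (forall x, finite_set [set n | H n x]) -> 0 < e ->
  exists n, (mu (H n) < e%:E)%E.
Proof.
move=> mD finD mH HD finH e0.
pose E n := \bigcup_(i in [set i | (n <= i)%N]) H i.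
have mE n : measurable (E n) by exact: bigcup_measurable.
have cap0 : \bigcap_n E n = set0.
  rewrite -subset0 => x Ex.
  have [N HN] : exists N, forall n, H n x -> (n < N)%N.
    have /finite_seqP[s sE] := finH x.
    exists (\max_(i <- s) i).+1 => n Hnx; rewrite ltnS.
    have ns : n \in s by have : [set` s] n by rewrite -sE.
    exact: (@leq_bigmax_seq _ s xpredT id n).
  have [i /= Ni /HN] := Ex N I; by rewrite ltnNge Ni.
have cE : mu \o E @ \oo --> mu set0.
  rewrite -cap0; apply: nonincreasing_cvg_mu => //.
  - apply: le_lt_trans finD; apply: le_measure; rewrite ?inE//.
    by move=> x [i _ /HD].
  - exact: bigcapT_measurable.
  - by move=> n m nm; apply/subsetPset => x [i /= mi Hi]; exists i => //=; exact: leq_trans mi.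
rewrite measure0 in cE.
have /= : \forall n \near \oo, (mu (E n) < e%:E)%E.
  by apply: (cE [set y | (y < e%:E)%E]); apply: open_nbhs_nbhs; split; [exact: open_ereal_lt_ereal|rewrite /= lte_fin].
case=> n _ /(_ n (leqnn n)) /= En; exists n; apply: le_lt_trans En.
by apply: le_measure; rewrite ?inE// => x Hx; exists n => //=.
Qed.

(** Sets with at most one point in each class of the reals modulo the
rationals. *)
Definition rationally_independent (R : realType) (E : set R) :=
  forall x y, E x -> E y -> (exists q : rat, y = x + ratr q) -> x = y.

Lemma lebesgue_measure_translate (R : realType) (q : R) (A : set R) :
  measurable A ->
  lebesgue_measure ((fun x : R => x + q) @^-1` A) = lebesgue_measure A.
Proof.
move=> mA.
have mf : measurable_fun [set: measurableTypeR R]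
    ((fun x : R => x + q) : measurableTypeR R -> measurableTypeR R).
  exact: measurable_funD.
pose f : measurableTypeR R -> measurableTypeR R := fun x => (x : R) + q.
change (pushforward (@lebesgue_measure R) f A = lebesgue_measure A).
apply/esym/lebesgue_measure_unique => //= _ [[a b]] _ <-.
rewrite /pushforward.
have -> : f @^-1` [set` `]a, b]] = [set` `]a - q, b - q]].
  by apply/seteqP; split => x /=; rewrite !in_itv/= ltrBlDr lerBrDr.
by rewrite !lebesgue_measure_itv/= !lte_fin ltrD2r -!EFinB; case: ifP => // _; congr EFin; ring.
Qed.

(** The translates of [B] by the numbers [1/(n+1)] are disjoint and lie in a
bounded interval. *)
Lemma vitali_null (R : realType) (M : R) (B : set R) :
  measurable B -> B `<=` `[0, M]%classic -> rationally_independent B ->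
  lebesgue_measure B = 0%E.
Proof.
move=> mB BM iB.
pose q n : R := ratr (n.+1%:R^-1).
have q01 n : 0 <= q n <= 1.
  rewrite /q fmorphV/= ratr_nat invr_ge0 ler0n/=.
  by rewrite invf_le1 ?ltr0n// ler1n.
have qinj : injective q.
  move=> n m /fmorph_inj/invr_inj/eqP.
  by rewrite eqr_nat => /eqP[].
pose H n := (fun x : R => x + - q n) @^-1` B.
have mH n : measurable (H n).
  have mf : measurable_fun [set: R] (fun x : R => x + - q n).
    exact: measurable_funD.
  by rewrite -[H n]setTI; exact: mf.
apply/eqP; rewrite eq_le measure_ge0 andbT.
apply/lee_addgt0Pr => e e0; rewrite add0e.
have finI : (lebesgue_measure (`[0%R, (M + 1)%R]%classic : set R) < +oo)%E.
  by rewrite lebesgue_measure_itv; case: ifP; rewrite ?ltry.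
have [|||n x|x||n] := @point_finite_small _ _ R (@lebesgue_measure R) `[0, M + 1]%classic H e.
- exact: measurable_itv.
- exact: finI.
- by [].
- move=> /BM/=; rewrite !in_itv/= => /andP[x0 xM].
  have /andP[q0 q1] := q01 n.
  move: (q n) x0 xM q0 q1 => z x0 xM q0 q1; apply/andP; split; lra.
- apply: (@sub_finite_set _ _ [set get [set n | H n x]]); last exact: finite_set1.
  move=> n Hn /=.
  have := @getPex _ [set n | H n x] (ex_intro _ n Hn).
  set m := get _ => /= Hm; apply: qinj.
  have -> // : q n = q m.
  suff /addrI/oppr_inj : x + - q n = x + - q m by [].
  apply: iB => //; exists (n.+1%:R^-1 - m.+1%:R^-1).
  rewrite /q rmorphB/=; ring.
- by [].
- have Hn : lebesgue_measure (H n) = lebesgue_measure B.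
    exact: lebesgue_measure_translate.
  by move=> /ltW; rewrite -Hn.
Qed.

(** * Functions all of whose preimages are measurable *)

(** Lebesgue measure is the outer measure generated by the lengths of
intervals, so that [B] need not be a Borel set. *)
Lemma lebesgue_dominates d (X : measurableType d) (R : realType)
    (mu : {measure set X -> \bar R}) (D : set X) (g : X -> R) :
  (forall E, measurable (D `&` g @^-1` E)) ->
  (forall a b, a <= b ->
     (mu (D `&` g @^-1` `]a, b]%classic) <= (b - a)%:E)%E) ->
  forall B : set R, (mu (D `&` g @^-1` B) <= lebesgue_measure B)%E.
Proof.
move=> mg gab B.
apply: le_ereal_inf_tmp => _ [A [mA BA] <-].
apply: (@le_trans _ _ (\sum_(0 <= n <oo) mu (D `&` g @^-1` (A n)))%E).
  apply: measure_sigma_subadditive => //.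
  by rewrite -setI_bigcupr -preimage_bigcup; apply: setIS; exact: preimage_subset.
apply: lee_nneseries => // n _.
have [[a b] _ <-] := mA n.
have [ab|ba] := leP a b; first by rewrite /= wlength_itv_bnd//; exact: gab.
rewrite /= set_itv_ge; last by rewrite bnd_simp -leNgt ltW.
by rewrite preimage_set0 setI0 measure0 wlength0.
Qed.

Lemma countType_enum (T : countType) :
  exists e : nat -> option T, forall x, exists n, e n = Some x.
Proof. by exists unpickle => x; exists (pickle x); exact: pickleK. Qed.

(** In this section every preimage of [h], restricted to [D], is measurable,
and the fibres of [h] are null. *)
Section mass_below_function.
Variables (d : measure_display) (X : measurableType d) (R : realType).
Variables (mu : {finite_measure set X -> \bar R}) (D : set X) (h : X -> R).
Hypothesis mh : forall E, measurable (D `&` h @^-1` E).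
Hypothesis h0 : forall t, mu (D `&` h @^-1` [set t]) = 0%E.

(** The distribution function of [h] restricted to [D]. *)
Definition mass_below (t : R) : R := fine (mu (D `&` h @^-1` `]-oo, t]%classic)).

Local Notation c := mass_below.

Lemma mass_below_itv s t : s <= t ->
  mu (D `&` h @^-1` `]s, t]%classic) = (c t - c s)%:E.
Proof.
move=> st.
rewrite EFinB !fineK ?fin_num_measure//.
have -> : `]-oo, t]%classic = `]-oo, s]%classic `|` `]s, t]%classic :> set R.
  apply/seteqP; split => x /=; rewrite !in_itv/=.
    by move=> ->; case: (leP x s); [left|right].
  by move=> [xs|/andP[]//]; exact: le_trans st.
rewrite preimage_setU setIUr measureU//; last first.
  rewrite -subset0 => x [[_ /= +] [_ /=]]; rewrite !in_itv/= => xs /andP[sx _].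
  by move: (lt_le_trans sx xs); rewrite ltxx.
by rewrite addeAC subee ?add0e// fin_num_measure.
Qed.

Lemma mass_below_ge0 t : 0 <= c t.
Proof. exact: fine_ge0. Qed.

Lemma mass_below_le t : c t <= fine (mu D).
Proof.
have mD : measurable D by have := mh setT; rewrite preimage_setT setIT.
apply: fine_le; rewrite ?fin_num_measure//.
by apply: le_measure; rewrite ?inE//; exact: subIsetl.
Qed.

Lemma mass_below_nondecreasing s t : s <= t -> c s <= c t.
Proof.
move=> st; rewrite -subr_ge0 -lee_fin -mass_below_itv//.
Qed.

Lemma subsingleton_null (E : set R) : (forall s t, E s -> E t -> s = t) ->
  mu (D `&` h @^-1` E) = 0%E.
Proof.
move=> E1; have [->|/set0P[t Et]] := eqVneq E set0; first by rewrite preimage_set0 setI0 measure0.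
suff -> : E = [set t] by exact: h0.
by apply/seteqP; split => s /= => [Es|->//]; exact: E1.
Qed.

(** Composed with its distribution function, [h] is dominated by Lebesgue
measure on intervals. *)
Lemma mass_below_strip (a b : R) : a <= b ->
  (mu (D `&` h @^-1` [set t | (a < c t <= b)%R]) <= (b - a)%:E)%E.
Proof.
move=> ab; set V := [set t | _].
have [V0|/set0P[v Vv]] := eqVneq V set0.
  by rewrite V0 preimage_set0 setI0 measure0 lee_fin subr_ge0.
(* The strip [V] is convex: apart from its possible extrema [m1] and [m2], it is
   covered by the intervals ]p, q] with rational endpoints in [V]. *)
pose m1 := [set t | V t /\ forall s, V s -> t <= s].
pose m2 := [set t | V t /\ forall s, V s -> s <= t].
have [e enum_e] := countType_enum (rat * rat)%type.
pose W n : set R := if e n is Some (p, q) then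
  [set t | [/\ V (ratr p), V (ratr q) & ratr p < t <= ratr q]] else set0.
have VW : V `<=` \bigcup_n W n `|` m1 `|` m2.
  move=> t Vt; have [|nm1] := pselect (m1 t); first by left; right.
  have [|nm2] := pselect (m2 t); first by right.
  left; left.
  have [s1 Vs st] : exists2 s, V s & s < t.
    apply: contrapT => H; apply: nm1; split => // w Vw; rewrite leNgt.
    by apply/negP => ?; apply: H; exists w.
  have [u Vu tu] : exists2 s, V s & t < s.
    apply: contrapT => H; apply: nm2; split => // w Vw; rewrite leNgt.
    by apply/negP => ?; apply: H; exists w.
  have [p] := rat_in_itvoo st; rewrite in_itv/= => /andP[sp pt].
  have [q] := rat_in_itvoo tu; rewrite in_itv/= => /andP[tq qu].
  have [n en] := enum_e (p, q); exists n => //; rewrite /W en; split.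
  - move: Vs Vt => /andP[as1 _] /andP[_ tb]; apply/andP; split.
      by apply: (lt_le_trans as1); exact/mass_below_nondecreasing/ltW.
    by apply: le_trans tb; exact/mass_below_nondecreasing/ltW.
  - move: Vu Vt => /andP[_ ub] /andP[at1 _]; apply/andP; split.
      by apply: (lt_le_trans at1); exact/mass_below_nondecreasing/ltW.
    by apply: le_trans ub; exact/mass_below_nondecreasing/ltW.
  - by rewrite pt ltW.
pose U n := D `&` h @^-1` (\bigcup_(i in `I_n) W i).
have mU n : measurable (U n) by exact: mh.
(* Each finite union of these intervals lies in a single interval ]s, u] with
   endpoints in [V]. *)
have Uab n : (mu (U n) <= (b - a)%:E)%E.
  have [s [u [Vs Vu su]]] : exists s u, [/\ V s, V u &
      \bigcup_(i in `I_n) W i `<=` `]s, u]%classic].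
    elim: n => [|n [s [u [Vs Vu IH]]]].
      by exists v, v; split => // t [].
    case E : (e n) => [[p q]|]; last first.
      exists s, u; split => // t [i /=]; rewrite ltnS leq_eqVlt => /predU1P[->|im Wi].
        by rewrite /W E => -[].
      by apply: IH; exists i.
    have [[Vp Vq]|nV] := pselect (V (ratr p) /\ V (ratr q)); last first.
      exists s, u; split => // t [i /=]; rewrite ltnS leq_eqVlt => /predU1P[->|im Wi].
        by rewrite /W E => -[Vp Vq _]; case: nV; split.
      by apply: IH; exists i.
    exists (Num.min s (ratr p)), (Num.max u (ratr q)); split => //.
    - by rewrite /Num.min; case: ifP.
    - by rewrite /Num.max; case: ifP.
    - move=> t [i /=]; rewrite ltnS leq_eqVlt => /predU1P[->|im Wi].
        rewrite /W E => -[_ _ /andP[pt tq]].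
        by rewrite in_itv/= gt_min pt orbT/= le_max tq orbT.
      have : t \in `]s, u] by apply: IH; exists i.
      by rewrite !in_itv/= => /andP[st tu]; rewrite gt_min st/= le_max tu.
  apply: (@le_trans _ _ (mu (D `&` h @^-1` `]Num.min s u, Num.max s u]%classic))).
    apply: le_measure; rewrite ?inE//; apply: setIS; apply: preimage_subset.
    apply: (subset_trans su) => t /=; rewrite !in_itv/= => /andP[st tu].
    by rewrite gt_min st/= le_max tu orbT.
  have Vm : V (Num.min s u) by rewrite /Num.min; case: ifP.
  have VM : V (Num.max s u) by rewrite /Num.max; case: ifP.
  rewrite mass_below_itv ?lee_fin; last by rewrite ge_min le_max lexx.
  move: Vm VM => /= /andP[? _] /andP[_ ?].
  by apply: lerB => //; exact: ltW.
have mW : mu (D `&` h @^-1` (\bigcup_n W n)) = limn (mu \o U).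
  apply/esym/cvg_lim => //.
  have -> : D `&` h @^-1` (\bigcup_n W n) = \bigcup_n U n.
    apply/seteqP; split => [x [Dx [n _ Wn]]|x [n _ [Dx [i _ Wi]]]].
      by exists n.+1 => //; split => //; exists n => //=.
    by split => //; exists i.
  apply: nondecreasing_cvg_mu => //.
  - exact: bigcupT_measurable.
  - move=> n m nm; apply/subsetPset; apply: setIS; apply: preimage_subset.
    by move=> x [i /= ni Wi]; exists i => //=; exact: leq_trans nm.
have m10 : mu (D `&` h @^-1` m1) = 0%E.
  apply: subsingleton_null => s t [Vs ms] [Vt mt].
  by apply/eqP; rewrite eq_le ms// mt.
have m20 : mu (D `&` h @^-1` m2) = 0%E.
  apply: subsingleton_null => s t [Vs ms] [Vt mt].
  by apply/eqP; rewrite eq_le ms// mt.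
apply: (@le_trans _ _ (mu (D `&` h @^-1` (\bigcup_n W n `|` m1 `|` m2)))).
  by apply: le_measure; rewrite ?inE//; apply: setIS; exact: preimage_subset.
rewrite !preimage_setU !setIUr measureU0//; last exact: measurableU.
rewrite measureU0//; apply: (@le_trans _ _ (limn (mu \o U))).
  by rewrite -mW.
apply: lime_le; last by near=> n; exact: Uab.
apply: ereal_nondecreasing_is_cvgn => n m nm /=.
apply: le_measure; rewrite ?inE//; apply: setIS; apply: preimage_subset.
by move=> x [i /= ni Wi]; exists i => //=; exact: leq_trans nm.
Unshelve. all: by end_near. Qed.

End mass_below_function.

Lemma borel_set_measurable (R : realType) (B : set R) :
  borel_set B -> measurable B.
Proof.
apply: smallest_sub; first exact: sigma_algebra_measurable.
by move=> U oU; exact: open_measurable.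
Qed.

Section rational_classes.
Variable R : realType.

(** The class of [x] modulo the rationals. *)
Definition rational_class (x : R) : set R := [set z | exists q : rat, z = x + ratr q].

(** A representative of the class of [x], depending only on this class; the
default value 0 is never used, as classes are not empty. *)
Definition rational_repr (x : R) : R := xget 0 (rational_class x).

Lemma rational_reprP x : exists q : rat, rational_repr x = x + ratr q.
Proof.
rewrite /rational_repr; case: xgetP => [y _ //|/(_ x)[]].
by exists 0; rewrite rmorph0 addr0.
Qed.

Lemma rational_repr_eq x y : (exists q : rat, y = x + ratr q) ->
  rational_repr y = rational_repr x.
Proof.
move=> [q ->]; congr (xget 0 _); apply/seteqP; split => z [p ->].
  by exists (q + p); rewrite rmorphD/= addrA.
by exists (p - q); rewrite rmorphB/=; ring.
Qed.

End rational_classes.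

(** A perfect measure has no diffuse image defined on all sets of reals.  If all
the fibres were null, composing [h] with its distribution function would give
[g], dominated by Lebesgue measure; the translates of a Vitali set by rationals
cover the values of [g] on [D], and by perfectness each of them has a null
preimage. *)
Lemma perfect_measure_atom d (X : measurableType d) (R : realType)
    (mu : {finite_measure set X -> \bar R}) (D : set X) (h : X -> R) :
  perfect_measure mu ->
  (forall E, measurable (D `&` h @^-1` E)) -> mu D != 0%E ->
  exists t, mu (D `&` h @^-1` [set t]) != 0%E.
Proof.
move=> pmu mh D0; apply: contrapT => nt.
have h0 t : mu (D `&` h @^-1` [set t]) = 0%E.
  by apply/eqP; apply: contra_notT nt => ht; exists t.
have mD : measurable D by have := mh setT; rewrite preimage_setT setIT.
pose c := mass_below mu D h.
pose M := fine (mu D).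
(* The value -1 outside [D] is not a value of [c], which is nonnegative. *)
pose g x := if x \in D then c (h x) else -1.
have gE E : D `&` g @^-1` E = D `&` h @^-1` (c @^-1` E).
  by apply/seteqP; split => x [Dx]; rewrite /preimage/= /g (mem_set Dx).
have mg E : measurable (D `&` g @^-1` E) by rewrite gE; exact: mh.
have gD E : E `<=` `[0, M]%classic -> g @^-1` E `<=` D.
  move=> EM x /EM /=; rewrite /g; case: ifP => [/set_mem //|_].
  by rewrite in_itv/= lerNr oppr0 ler10.
have mgE E : measurable (g @^-1` E).
  have -> : g @^-1` E = (D `&` g @^-1` E) `|` (~` D `&` [set _ | E (-1)]).
    apply/seteqP; split => [x|x [[]//|[Dx /=]]].
      have [Dx|Dx] := pselect (D x); first by left.
      by rewrite /preimage/= /g memNset// => E1; right.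
    by rewrite /g memNset.
  apply: measurableU => //; apply: measurableI; first exact: measurableC.
  have [E1|E1] := pselect (E (-1)).
    by rewrite [X in measurable X](_ : _ = setT)//; apply/seteqP; split.
  by rewrite [X in measurable X](_ : _ = set0)//; apply/seteqP; split.
have dom := @lebesgue_dominates _ _ _ mu D g mg.
have {}dom (B : set R) : (mu (D `&` g @^-1` B) <= lebesgue_measure B)%E.
  apply: dom => a b ab; rewrite gE.
  exact: (mass_below_strip mh h0 ab).
pose E (q : rat) := [set y : R | 0 <= y <= M /\ exists x, y = rational_repr x + ratr q].
have indepE q : rationally_independent (E q).
  move=> _ _ [_ [x ->]] [_ [y ->]] [p xy]; congr (_ + _).
  have [px xE] := rational_reprP x.
  have [py yE] := rational_reprP y.
  apply/esym/rational_repr_eq; exists (px + p - py).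
  rewrite rmorphB rmorphD/=; lra.
have E0 q : mu.-negligible (g @^-1` E q).
  have [|B [bB BE mB]] := pmu g _ (E q) (mgE _); first by move=> U _; exact: mgE.
  have EM : E q `<=` `[0, M]%classic by move=> y [yM _]; rewrite /= in_itv/=.
  apply/negligibleP => //.
  apply/eqP; rewrite eq_le measure_ge0 andbT [X in (X <= _)%E]mB.
  have -> : g @^-1` B = D `&` g @^-1` B.
    by apply/esym/setIidr/gD; exact: subset_trans EM.
  apply: le_trans (dom _) _.
  suff -> : lebesgue_measure B = 0%E by [].
  apply: (@vitali_null _ M) => //.
  - exact: borel_set_measurable.
  - exact: subset_trans EM.
  - by move=> x y /BE Ex /BE Ey; exact: (indepE q _ _ Ex Ey).
move/eqP: D0; apply; apply/negligibleP => //.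
have [e enum_e] := countType_enum rat.
pose N n := if e n is Some q then g @^-1` E q else set0.
apply: (@negligibleS _ _ _ _ (\bigcup_n N n)); last first.
  apply: negligible_bigcup => n; rewrite /N; case: (e n) => //.
  exact: negligible_set0.
move=> x Dx.
have [q qE] := rational_reprP (g x).
have [n en] := enum_e (- q).
exists n => //; rewrite /N en; split; last first.
  by exists (g x); rewrite qE rmorphN/=; ring.
by rewrite /g (mem_set Dx) mass_below_ge0 mass_below_le.
Qed.

(** * Finite-valued maps all of whose hit sets are measurable *)

(** The set of the points [x] at which [G x] meets [T]. *)
Definition hit (X A : Type) (G : X -> set A) (T : set A) : set X :=
  [set x | G x `&` T !=set0].

Lemma hit_subset (X A : Type) (G : X -> set A) (S T : set A) :
  S `<=` T -> hit G S `<=` hit G T.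
Proof. by move=> ST x [a [Ga /ST Ta]]; exists a. Qed.

Lemma finite_isolated (R : realFieldType) (A : set R) (a : R) :
  finite_set A -> exists2 e : R, 0 < e & forall b, A b -> `|b - a| < e -> b = a.
Proof.
move=> /finite_seqP[s ->]; elim: s => [|c s [e e0 es]]; first by exists 1.
have [->|ca] := eqVneq c a.
  by exists e => // b; rewrite /= inE => /predU1P[->//|/es]; apply.
have ca0 : 0 < `|c - a| by rewrite normr_gt0 subr_eq0.
exists (Num.min e `|c - a|); first by rewrite lt_min e0.
move=> b; rewrite /= inE lt_min => /predU1P[->|bs /andP[+ _]]; last exact: es.
by rewrite ltxx andbF.
Qed.

Section finite_valued.
Variables (d : measure_display) (X : measurableType d) (R : realType).
Variable mu : {finite_measure set X -> \bar R}.
Hypothesis pmu : perfect_measure mu.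

(** The points where [G x] meets a rational interval exactly once cover
[hit G setT], and on each of these sets [perfect_measure_atom] applies to the
only element of [G x] in the interval. *)
Lemma real_point_not_negligible (G : X -> set R) :
  (forall x, finite_set (G x)) -> (forall E, measurable (hit G E)) ->
  ~ mu.-negligible (hit G setT) -> exists t, ~ mu.-negligible (hit G [set t]).
Proof.
move=> finG mG G0; apply: contrapT => nt; apply: G0.
have null t : mu.-negligible (hit G [set t]).
  by apply: contrapT => ht; apply: nt; exists t.
pose D (p q : R) := hit G `]p, q[%classic `\` \bigcup_(r : rat)
  (hit G `]p, ratr r]%classic `&` hit G `]ratr r, q[%classic).
have mD p q : measurable (D p q).
  apply: measurableD => //; apply: bigcupT_measurable_rat => r.
  exact: measurableI.
have D1 p q x a b : D p q x -> (G x `&` `]p, q[%classic) a ->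
    (G x `&` `]p, q[%classic) b -> a = b.
  have key u v : D p q x -> (G x `&` `]p, q[%classic) u ->
      (G x `&` `]p, q[%classic) v -> ~ u < v.
    move=> [_ nD] [Gu /=]; rewrite in_itv/= => /andP[pu uq] [Gv /=].
    rewrite in_itv/= => /andP[pv vq] uv; apply: nD.
    have [r] := rat_in_itvoo uv; rewrite in_itv/= => /andP[ur rv].
    exists r => //; split; [exists u|exists v] => //; split => //=.
      by rewrite in_itv/= pu ltW.
    by rewrite in_itv/= rv.
  by move=> Dx Ga Gb; have [/(key _ _ Dx Ga Gb)|/(key _ _ Dx Gb Ga)|] := ltgtP a b.
have D0 p q : mu.-negligible (D p q).
  apply/negligibleP => //; apply/eqP; apply: contra_notT nt => Dpq.
  pose h x := xget 0 (G x `&` `]p, q[%classic).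
  have hP x : D p q x -> (G x `&` `]p, q[%classic) (h x).
    by move=> [+ _]; rewrite /h => -[a Ga]; case: xgetP => // /(_ a).
  have hE E : D p q `&` h @^-1` E = D p q `&` hit G (E `&` `]p, q[%classic).
    apply/seteqP; split => x [Dx].
      by move=> Ehx; split => //; exists (h x); have [? ?] := hP _ Dx.
    move=> [a [Ga [Ea apq]]]; split => //=.
    by rewrite /preimage/= (D1 p q x (h x) a)//; exact: hP.
  have [||t tD] := @perfect_measure_atom _ _ _ mu (D p q) h pmu => //.
    by move=> E; rewrite hE; exact: measurableI.
  exists t => ht; move/eqP: tD; apply; apply/negligibleP.
    by rewrite hE; exact: measurableI.
  by apply: negligibleS ht; rewrite hE => x [_]; apply: hit_subset => a [].
have [e enum_e] := countType_enum (rat * rat)%type.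
pose N n := if e n is Some (p, q) then D (ratr p) (ratr q) else set0.
apply: (@negligibleS _ _ _ _ (\bigcup_n N n)); last first.
  apply: negligible_bigcup => n; rewrite /N; case: (e n) => [[p q]|] //.
  exact: negligible_set0.
move=> x [a [Ga _]].
have [eps eps0 epsP] := finite_isolated a (finG x).
have [|p] := @rat_in_itvoo R (a - eps) a; first by rewrite ltrBlDr ltrDl.
rewrite in_itv/= => /andP[ap pa].
have [|q] := @rat_in_itvoo R a (a + eps); first by rewrite ltrDl.
rewrite in_itv/= => /andP[aq qa].
have [n en] := enum_e (p, q); exists n => //; rewrite /N en; split.
  by exists a; split => //=; rewrite in_itv/= pa aq.
move=> [r _ [[u [Gu /=]] + [v [Gv /=]]]]; rewrite !in_itv/=.
move=> /andP[pu ur] /andP[rv vq].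
have ua : u = a by apply: epsP => //; rewrite ltr_norml; apply/andP; split; lra.
have va : v = a by apply: epsP => //; rewrite ltr_norml; apply/andP; split; lra.
by move: (le_lt_trans ur rv); rewrite ua va ltxx.
Qed.

Section hits.
Variables (A : Type) (G : X -> set A).
Hypothesis finG : forall x, finite_set (G x).
Hypothesis mG : forall T, measurable (hit G T).

Local Notation null T := (mu.-negligible (hit G T)).

Lemma null_subset S T : S `<=` T -> null T -> null S.
Proof. by move=> ST; apply: negligibleS; exact: hit_subset. Qed.

Lemma disjoint_hit_small (T : nat -> set A) (e : R) :
  (forall n m a, T n a -> T m a -> n = m) -> 0 < e ->
  exists n, (mu (hit G (T n)) < e%:E)%E.
Proof.
move=> T1 e0; apply: (@point_finite_small _ _ _ mu setT) => //.
  by rewrite -ge0_fin_numE// fin_num_measure.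
move=> x; apply: (@sub_finite_set _ _ (\bigcup_(a in G x) [set n | T n a])).
  by move=> n [a [Ga Ta]]; exists a.
apply: bigcup_finite => // a _.
apply: (@sub_finite_set _ _ [set xget 0%N [set n | T n a]]); last exact: finite_set1.
move=> n Tn /=; case: xgetP => [m _|/(_ n)//] Tm; exact: T1 Tm.
Qed.

(** Of any two complementary parts of [T], at least one is hit only on a null
set; in particular null sets are indivisible. *)
Definition indivisible (T : set A) :=
  forall S, S `<=` T -> null S \/ null (T `\` S).

Lemma null_indivisible T : null T -> indivisible T.
Proof. by move=> T0 S ST; left; exact: null_subset T0. Qed.

(** No non-null part of [T] is indivisible, so splittings into two non-null parts
can be iterated; the parts left aside form a disjoint sequence. *)
Lemma small_piece (T : set A) (e : R) : ~ null T -> 0 < e ->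
  (forall S, S `<=` T -> indivisible S -> null S) ->
  exists S, [/\ S `<=` T, ~ null S & (mu (hit G S) < e%:E)%E].
Proof.
move=> T0 e0 noI.
have /choice[f fP] : forall S : set A, exists S' : set A, S `<=` T -> ~ null S ->
    [/\ S' `<=` S, ~ null S' & ~ null (S `\` S')].
  move=> S; have [ST|] := pselect (S `<=` T); last by exists set0.
  have [|S0] := pselect (null S); first by exists set0.
  have /existsNP[S' /not_implyP[S'S /not_orP[? ?]]] : ~ indivisible S.
    by move=> /(noI _ ST).
  by exists S'.
pose S n := iter n f T.
have SP n : S n `<=` T /\ ~ null (S n).
  elim: n => [|n [ST S0]]; first by split.
  have [S'S S'0 _] := fP _ ST S0.
  by split => //; exact: subset_trans ST.
have S_ni n m : (n <= m)%N -> S m `<=` S n.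
  move=> /subnK <-; elim: (m - n)%N => [//|k IH].
  have [ST S0] := SP (k + n)%N; have [S'S _ _] := fP _ ST S0.
  exact: subset_trans IH.
have [|//|n nP] := @disjoint_hit_small (fun n => S n `\` S n.+1) e.
  have key n m a : (n < m)%N -> (S n `\` S n.+1) a -> ~ (S m `\` S m.+1) a.
    by move=> nm [_ Sn] [Sm _]; apply: Sn; exact: S_ni Sm.
  move=> n m a Sn Sm; have [|/key/(_ Sm)//|//] := ltngtP n m.
  by move=> /key /(_ Sn).
have [ST S0] := SP n; have [_ _ ?] := fP _ ST S0.
by exists (S n `\` S n.+1); split => // a [/ST].
Qed.

(** A maximal disjoint family of non-null sets satisfying [P] is countable, and
its complement is null. *)
Lemma countable_exhaustion (P : set A -> Prop) :
  (forall T, ~ null T -> exists S, [/\ S `<=` T, P S & ~ null S]) ->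
  exists B : nat -> set A,
    (forall n, P (B n) \/ null (B n)) /\ (forall a, exists n, B n a).
Proof.
move=> Pex.
have [E [EP Etriv Emax]] :=
  ex_maximal_disjoint_subcollection id [set S : set A | P S /\ ~ null S].
(* For each [k] only finitely many members of [E] are hit with measure at least
   [1/(k+1)], by [disjoint_hit_small]. *)
have cE : countable E.
  have -> : E = \bigcup_k [set S | E S /\ ((k.+1%:R^-1)%:E <= mu (hit G S))%E].
    apply/seteqP; split => [S ES|S [k _ []//]].
    have [_ S0] := EP _ ES.
    have Spos : (0 < mu (hit G S))%E.
      rewrite lt0e measure_ge0 andbT; apply/eqP => /negligibleP-/(_ (mG _)).
      exact: S0.
    have muS : (fine (mu (hit G S)))%:E = mu (hit G S).
      by rewrite fineK ?fin_num_measure.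
    have fpos : 0 < fine (mu (hit G S)) by rewrite -lte_fin muS.
    have [k _ kP] := near_infty_natSinv_lt (PosNum fpos).
    exists k => //; split => //.
    rewrite -muS lee_fin ltW//; exact: (kP k (leqnn k)).
  apply: bigcup_countable => // k _; apply: finite_set_countable.
  apply: contrapT => /infiniteP/pcard_leP/injfunPex[T TE Tinj].
  have [||n] := @disjoint_hit_small T (k.+1%:R^-1).
  - move=> n m a Tn Tm; apply: Tinj; rewrite ?inE//.
    have [[ETn _] [ETm _]] := (TE n I, TE m I).
    by apply: Etriv => //; exists a.
  - by rewrite invr_gt0.
  - by rewrite ltNge => /negP; apply; have [] := TE n I.
have [f finj] := elimT (countable_injP E) cE.
pose B n := if n is k.+1 then \bigcup_(S in [set S | E S /\ f S = k]) S
            else ~` \bigcup_(S in E) S.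
exists B; split; last first.
  move=> a; have [[S ES Sa]|nEa] := pselect ((\bigcup_(S in E) S) a).
    by exists (f S).+1, S.
  by exists 0%N.
case=> [|k].
  right; apply: contrapT => /Pex[S [SB PS S0]].
  have SE (T : set A) : E T -> (T `&` S) !=set0 -> False.
    by move=> ET [a [Ta /SB]]; apply; exists T.
  have Sne : S !=set0.
    apply/set0P; apply/eqP => SE0; apply: S0; rewrite SE0.
    by apply: (@negligibleS _ _ _ _ set0); [move=> x [a []]|exact: negligible_set0].
  apply: (Emax (E `|` [set S])).
  - split; first by move=> T; left.
    move=> /(_ S (or_intror erefl)) ES; apply: (SE S) => //.
    by rewrite setIid.
  - by move=> T [/EP//|->].
  - move=> T1 T2 [E1|->] [E2|->] //=.
    + exact: Etriv.
    + by move=> /SE; case.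
    + by rewrite setIC => /SE; case.
have [[S [ES fS]]|nS] := pselect (exists S, E S /\ f S = k).
  left; suff -> : B k.+1 = S by have [] := EP _ ES.
  apply/seteqP; split => [a [S' [ES' fS'] S'a]|a Sa]; last by exists S.
  by have <- : S' = S by apply: finj; rewrite ?inE// fS.
right; apply: (@negligibleS _ _ _ _ set0); last exact: negligible_set0.
by move=> x [a [_ [S ? _]]]; case: nS; exists S.
Qed.

End hits.
End finite_valued.

(** * Coding sequences of integers by reals *)

Section ternary.
Variable R : realType.
Implicit Types s t : nat -> bool.

Definition ternary_sum s n : R := \sum_(k < n) (s k)%:R * 3^-1 ^+ k.

Lemma ternary_sumS s n : ternary_sum s n.+1 = ternary_sum s n + (s n)%:R * 3^-1 ^+ n.
Proof. exact: big_ord_recr. Qed.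

Lemma ternary_sum_tail s n j :
  ternary_sum s (n + j) <= ternary_sum s n + 3 / 2 * (3^-1 ^+ n - 3^-1 ^+ (n + j)).
Proof.
elim: j => [|j IH]; first by rewrite addn0 subrr mulr0 addr0.
rewrite addnS ternary_sumS exprS.
have p0 : 0 <= 3^-1 ^+ (n + j) :> R by rewrite exprn_ge0// invr_ge0.
have : (s (n + j)%N)%:R * 3^-1 ^+ (n + j) <= 3^-1 ^+ (n + j) :> R.
  by case: (s _); rewrite ?mul1r// mul0r.
lra.
Qed.

Lemma ternary_sum_ge s n j : ternary_sum s n <= ternary_sum s (n + j).
Proof.
elim: j => [|j IH]; first by rewrite addn0.
rewrite addnS ternary_sumS (le_trans IH)// lerDl mulr_ge0 //.
Qed.

Lemma ternary_sum_le s n m :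
  ternary_sum s m <= ternary_sum s n + 3 / 2 * 3^-1 ^+ n.
Proof.
have p0 k : 0 <= 3^-1 ^+ k :> R by rewrite exprn_ge0// invr_ge0.
have [mn|/ltnW nm] := leqP m n.
  apply: (@le_trans _ _ (ternary_sum s n)).
    by rewrite -(subnKC mn); exact: ternary_sum_ge.
  by rewrite lerDl mulr_ge0.
rewrite -(subnKC nm); apply: le_trans (ternary_sum_tail _ _ _) _.
have := p0 (n + (m - n))%N; lra.
Qed.

(** The real number whose ternary digits are the terms of [s]; distinct
sequences of zeroes and ones yield distinct numbers. *)
Definition ternary_real s : R := sup (range (ternary_sum s)).

Lemma has_sup_ternary s : has_sup (range (ternary_sum s)).
Proof.
split; first by exists (ternary_sum s 0), 0%N.
exists (ternary_sum s 0 + 3 / 2 * 3^-1 ^+ 0) => _ [n _ <-].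
exact: ternary_sum_le.
Qed.

Lemma ternary_real_lt s t m : (forall k, (k < m)%N -> s k = t k) ->
  s m -> ~~ t m -> ternary_real t < ternary_real s.
Proof.
move=> st sm /negbTE tm.
have p0 : 0 < 3^-1 ^+ m :> R by rewrite exprn_gt0// invr_gt0.
have stm : ternary_sum s m = ternary_sum t m.
  by apply: eq_bigr => k _; rewrite st.
apply: (@le_lt_trans _ _ (ternary_sum t m.+1 + 3 / 2 * 3^-1 ^+ m.+1)).
  apply: ge_sup; first by have [] := has_sup_ternary t.
  by move=> _ [n _ <-]; exact: ternary_sum_le.
apply: (@lt_le_trans _ _ (ternary_sum s m.+1)); last first.
  by apply: ub_le_sup; [have [] := has_sup_ternary s|exists m.+1].
rewrite !ternary_sumS stm sm tm mul0r mul1r exprS; lra.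
Qed.

Lemma ternary_real_inj : injective ternary_real.
Proof.
move=> s t est; apply/funext => k; apply: contrapT => /eqP stk.
pose P n := s n != t n.
have exP : exists n, P n by exists k.
case: (ex_minnP exP) => m Pm min_m.
have stm j : (j < m)%N -> s j = t j.
  by move=> jm; apply/eqP; apply: contraTT jm => /min_m; rewrite -leqNgt.
move: Pm; rewrite /P; case sm: (s m); case tm: (t m) => // _.
  by have := @ternary_real_lt s t m stm sm (negbT tm); rewrite est ltxx.
have tsm j : (j < m)%N -> t j = s j by move=> /stm.
by have := @ternary_real_lt t s m tsm tm (negbT sm); rewrite est ltxx.
Qed.

Lemma sequences_inject_reals : exists e : (nat -> nat) -> R, injective e.
Proof.
have [en enP] := countType_enum (nat * nat)%type.
pose code (f : nat -> nat) n := if en n is Some (i, j) then f i == j else false.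
exists (ternary_real \o code); apply: inj_comp; first exact: ternary_real_inj.
move=> f g fg; apply/funext => i.
have [n ni] := enP (i, f i).
by move/(congr1 (@^~ n)): fg; rewrite /code ni eqxx => /esym/eqP.
Qed.

End ternary.

(** * Covering by indivisible sets *)

Lemma indivisible_cover d (X : measurableType d) (R : realType)
    (mu : {finite_measure set X -> \bar R}) (A : Type) (G : X -> set A) :
  perfect_measure mu -> (forall x, finite_set (G x)) ->
  (forall T, measurable (hit G T)) ->
  exists B : nat -> set A, (forall n, indivisible mu G (B n)) /\
    mu.-negligible (hit G (~` \bigcup_n B n)).
Proof.
move=> pmu finG mG.
pose null T := mu.-negligible (hit G T).
have /choice[B BP] : forall k, exists B : nat -> set A,
    (forall n, indivisible mu G (B n) \/ (mu (hit G (B n)) <= (k.+1%:R^-1)%:E)%E)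
    /\ (forall a, exists n, B n a).
  move=> k.
  have k0 : 0 < k.+1%:R^-1 :> R by rewrite invr_gt0.
  have [|B [PB coverB]] := @countable_exhaustion _ _ _ mu A G finG mG
    (fun S => indivisible mu G S \/ (mu (hit G S) <= (k.+1%:R^-1)%:E)%E).
    move=> T T0.
    have [noI|] := pselect (forall S, S `<=` T -> indivisible mu G S -> null S).
      have [S [ST S0 Sk]] := small_piece finG mG T0 k0 noI.
      by exists S; split => //; right; exact: ltW.
    by move=> /existsNP[S /not_implyP[ST /not_implyP[IS S0]]]; exists S; split => //; left.
  exists B; split => // n; have [//|/null_indivisible] := PB n.
  by left.
pose C := \bigcup_k \bigcup_(n in [set n | indivisible mu G (B k n)]) B k n.
have [en enP] := countType_enum (nat * nat)%type.
pose B' i := if en i is Some (k, n) then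
  (if pselect (indivisible mu G (B k n)) then B k n else set0) else set0.
have ind0 : indivisible mu G (@set0 A).
  apply: null_indivisible; apply: (@negligibleS _ _ _ _ set0).
    by move=> x [a []].
  exact: negligible_set0.
exists B'; split.
  by move=> i; rewrite /B'; case: (en i) => [[k n]|]//; case: pselect.
(* On [A'], every piece is hit with small measure, so that the fibres of the
   coding [e \o f] are null. *)
set A' := ~` _.
have A'P a k n : A' a -> B k n a -> (mu (hit G (B k n)) <= (k.+1%:R^-1)%:E)%E.
  move=> A'a Ba; have [ind|//] := (BP k).1 n.
  exfalso; apply: A'a; have [i ei] := enP (k, n); exists i => //.
  by rewrite /B' ei; case: pselect.
have /choice[f fP] : forall a, exists f : nat -> nat, forall k, B k (f k) a.
  by move=> a; have /choice[g gP] := fun k => (BP k).2 a; exists g.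
have [e einj] := sequences_inject_reals R.
pose H x := (e \o f) @` (G x `&` A').
have hitH E : hit H E = hit G (A' `&` (e \o f) @^-1` E).
  apply/seteqP; split => x.
    by move=> [_ [[a [Ga A'a] <-] Ea]]; exists a.
  by move=> [a [Ga [A'a Ea]]]; exists (e (f a)); split => //; exists a.
apply: contrapT => A'0.
have [|||t] := @real_point_not_negligible _ _ _ mu pmu H.
- by move=> x; apply: finite_image; exact: finite_setIl.
- by move=> E; rewrite hitH.
- by rewrite hitH preimage_setT setIT.
rewrite hitH; apply; apply/negligibleP => //.
apply/eqP; rewrite eq_le measure_ge0 andbT.
have [->|/set0P[a [A'a /= eta]]] := eqVneq (A' `&` (e \o f) @^-1` [set t]) set0.
  rewrite (_ : hit G set0 = set0) ?measure0//.
  by apply/seteqP; split => x // [? []].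
apply/lee_addgt0Pr => eps eps0; rewrite add0e.
have [k _ /(_ k (leqnn k))/= kP] := near_infty_natSinv_lt (PosNum eps0).
apply: (@le_trans _ _ (mu (hit G (B k (f a k))))).
  apply: le_measure; rewrite ?inE//; apply: hit_subset => b [_ /= etb].
  suff -> : f a = f b by [].
  by apply: einj; rewrite etb.
apply: le_trans (A'P _ _ _ A'a (fP _ _)) _.
by rewrite lee_fin ltW.
Qed.

(** * Small pieces of a metric space *)

Lemma infinite_set_sequence (T : Type) (A : set T) : infinite_set A ->
  exists2 a : nat -> T, (forall n, A (a n)) & injective a.
Proof.
elim/Ppointed: T => T in A *; first by rewrite emptyE => /(_ (finite_set0 _)).
move=> /infiniteP/pcard_leP/injfunPex[a aA ainj]; exists a => [n|n m anm].
  exact: aA.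
by apply: ainj; rewrite ?inE.
Qed.

Section metric_pieces.
Variables (R : realType) (Y : metricType R).

Lemma nbhs_mdist (x : Y) (e : R) : 0 < e -> nbhs x [set y | mdist x y < e].
Proof. by move=> e0; rewrite -ballEmdist; exact: nbhsx_ballx. Qed.

Lemma closure_mdistP (A : set Y) (y : Y) :
  closure A y <-> forall e, 0 < e -> exists2 z, A z & mdist y z < e.
Proof.
split=> [Ay e e0|Ay B].
  by have [z [Az yz]] := Ay _ (nbhs_mdist y e0); exists z.
rewrite -nbhs_ballE => -[e e0 yeB]; have [z Az yz] := Ay e e0.
by exists z; split => //; apply: yeB; rewrite ballEmdist.
Qed.

(** The map [p] sends [y] to the least point of [Y], for a fixed well-ordering,
at distance less than [eps] from [y].  If [p y] precedes [p z], then [p y] is at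
distance at least [eps] from [z]. *)
Lemma well_ordered_centers (eps : R) : 0 < eps ->
  exists p : Y -> Y, (forall y, mdist y (p y) < eps) /\
    forall r y z, mdist y (p y) <= eps - r -> mdist z (p z) <= eps - r ->
      p y <> p z -> r <= mdist y z.
Proof.
move=> eps0; have [le wo] := wochoice.well_ordering_principle Y.
have /choice[p pP] : forall y, exists a, mdist y a < eps /\
    forall b, mdist y b < eps -> le a b.
  move=> y; have [|a [[ya min_a] _]] := wo [pred a | mdist y a < eps].
    by exists y; rewrite inE mdistxx.
  by exists a; split => // b yb; apply: min_a.
have anti a b : le a b -> le b a -> a = b.
  move=> ab ba; have [|m [_ uniq_m]] := wo (pred2 a b).
    by exists a; rewrite !inE eqxx.
  have refl c : le c c.
    have [|n [[]]] := wo (pred1 c); first by exists c; rewrite inE.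
    by rewrite inE => /eqP -> /(_ c); rewrite inE => /(_ (eqxx _)).
  transitivity m; first (apply/esym; apply: uniq_m; split).
  - by rewrite !inE eqxx.
  - by move=> c; rewrite !inE => /orP[] /eqP ->.
  apply: uniq_m; split; first by rewrite !inE eqxx orbT.
  by move=> c; rewrite !inE => /orP[] /eqP ->.
have tot a b : le a b \/ le b a.
  have [|m [[+ min_m] _]] := wo (pred2 a b); first by exists a; rewrite !inE eqxx.
  rewrite !inE => /orP[] /eqP mE; [left|right]; rewrite -{1}mE; apply: min_m;
    by rewrite !inE eqxx ?orbT.
exists p; split; first by move=> y; have [] := pP y.
have key r y z : le (p y) (p z) -> mdist y (p y) <= eps - r -> p y <> p z ->
    r <= mdist y z.
  move=> yz yr pyz; rewrite leNgt; apply/negP => yzr; apply: pyz.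
  apply: anti => //; apply: (pP z).2.
  apply: le_lt_trans (metric_triangle z y (p y)) _.
  rewrite (metric_sym z y); lra.
move=> r y z yr zr pyz; have [le_yz|le_zy] := tot (p y) (p z).
  exact: (key _ _ _ le_yz).
by rewrite metric_sym; apply: (key _ _ _ le_zy) => // /esym.
Qed.

Lemma compact_nested (K : set Y) (E : nat -> set Y) :
  compact K -> (forall n m, (n <= m)%N -> E m `<=` E n) ->
  (forall n, E n `<=` K) -> (forall n, E n !=set0) ->
  exists2 y, K y & forall n, closure (E n) y.
Proof.
move=> cK niE EK E0.
pose FE := filter_from [set: nat] E.
have FF : ProperFilter FE.
  apply: filter_from_proper => //.
  apply: filter_from_filter; first by exists 0%N.
  move=> i j _ _; exists (maxn i j) => // y Ey.
  by split; apply: niE Ey; rewrite ?leq_maxl ?leq_maxr.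
have [|y [Ky cy]] := cK FE FF; first by exists 0%N.
exists y => // n B yB; apply: cy => //; by exists n.
Qed.

End metric_pieces.

(** * Compact-valued maps *)

Section multifunction.
Variables (d : measure_display) (X : measurableType d) (R : realType).
Variables (Y : metricType R) (F : X -> set Y).
Hypothesis cF : forall x, compact (F x).
Hypothesis mF : lower_measurable F.

(** By compactness, [F x] meets [C] when it meets every neighbourhood of [C] of
the form [U n]. *)
Lemma hit_closed_measurable (C : set Y) : closed C -> measurable (hit F C).
Proof.
move=> clC.
pose U n := \bigcup_(c in C) [set y | mdist c y < n.+1%:R^-1]^°.
have e0 n : 0 < n.+1%:R^-1 :> R by rewrite invr_gt0.
have -> : hit F C = \bigcap_n hit F (U n).
  apply/seteqP; split => [x [y [Fy Cy]] n _|x Ux].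
    by exists y; split => //; exists y => //; exact: nbhs_mdist.
  have [n m nm|n y []//|n|y Fy Ey] :=
    @compact_nested _ _ (F x) (fun n => F x `&` U n) (@cF x).
  - apply: setIS; apply: subset_bigcup => c _; apply: interiorS => y /= /lt_le_trans.
    by apply; rewrite lef_pV2 ?posrE// ler_nat.
  - exact: Ux.
  exists y; split => //; apply: clC; apply/closure_mdistP => e eps0.
  have [n ne] : exists n : nat, n.+1%:R^-1 < e / 2.
    have e20 : 0 < e / 2 by rewrite divr_gt0.
    by have [n _ nP] := near_infty_natSinv_lt (PosNum e20); exists n; exact: (nP n (leqnn n)).
  have /closure_mdistP/(_ _ (e0 n))[z [_ [c Cc /interior_subset/= cz]] yz] := Ey n.
  exists c => //; apply: le_lt_trans (metric_triangle y z c) _.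
  rewrite (metric_sym z c); set r := n.+1%:R^-1 in yz cz ne; lra.
apply: bigcapT_measurable => n; apply: mF.
by apply: bigcup_open => c _; exact: open_interior.
Qed.

Variable mu : {finite_measure set X -> \bar R}.
Hypothesis pmu : perfect_measure mu.

(** Almost every [F x] is covered by the pieces, and each piece behaves, for
almost every [x], as a set of diameter less than [4 * eps], although its
actual diameter may be large. *)
Lemma small_closed_cover (eps : R) : 0 < eps ->
  exists C : nat -> set Y, [/\ (forall i, closed (C i)),
    mu.-negligible [set x | ~ F x `<=` \bigcup_i C i] &
    forall i (D : set Y), mu.-negligible [set x | (F x `&` C i `&` D) !=set0 /\
      exists2 w, (F x `&` C i) w & forall z, D z -> 4 * eps <= mdist w z]].
Proof.
move=> eps0; have [p [p_near p_sep]] := well_ordered_centers Y eps0.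
pose r n : R := n.+1%:R^-1.
have r0 n : 0 < r n by rewrite invr_gt0.
pose Yn n : set Y := [set y | mdist y (p y) <= eps - r n].
pose U n (T : set Y) := \bigcup_(y in Yn n `&` p @^-1` T)
  [set z | mdist y z < r n / 3]^°.
have oU n T : open (U n T) by apply: bigcup_open => y _; exact: open_interior.
have UP n T z : U n T z -> exists u, [/\ Yn n u, T (p u) & mdist u z < r n / 3].
  by move=> [u [Yu Tu] /interior_subset uz]; exists u.
have U1 n (T : set Y) z : U n T z -> exists2 a, T a & U n [set a] z.
  by move=> [u [Yu Tu] uz]; exists (p u) => //; exists u.
have US n (S T : set Y) : S `<=` T -> U n S `<=` U n T.
  by move=> ST z [u [Yu Su] uz]; exists u => //; split => //; exact: ST.
have UY n (T : set Y) y : Yn n y -> T (p y) -> U n T y.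
  by move=> Yy Ty; exists y => //; apply: nbhs_mdist; rewrite divr_gt0.
have clU n T : closure (Yn n `&` p @^-1` T) `<=` U n T.
  move=> z /closure_mdistP clz.
  have r6 : 0 < r n / 6 by rewrite divr_gt0.
  have [u [Yu Tu] zu] := clz _ r6.
  exists u => //.
  apply: (@filterS _ _ _ [set y | mdist z y < r n / 6]); last exact: nbhs_mdist.
  move=> y /= zy; apply: le_lt_trans (metric_triangle u z y) _.
  rewrite (metric_sym u z); lra.
pose G n x : set Y := [set a | (F x `&` U n [set a]) !=set0].
have hitG n T : hit (G n) T = hit F (U n T).
  apply/seteqP; split => x.
    by move=> [a [[z [Fz Uz]] Ta]]; exists z; split => //; apply: US Uz => _ ->.
  by move=> [z [Fz /U1[a Ta Uz]]]; exists a; split => //; exists z.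
have mG n T : measurable (hit (G n) T) by rewrite hitG; exact: mF.
(* For different [a] the sets [U n [set a]] are at distance at least [r n / 3]
   from each other, so that the compact set [F x] meets finitely many. *)
have finG n x : finite_set (G n x).
  apply: contrapT => /infinite_set_sequence[a aG ainj].
  have /choice[y yP] : forall i, exists y, F x y /\ U n [set a i] y.
    by move=> i; have [y [? ?]] := aG i; exists y.
  have [i j ij|i z [m _ <-]|i|z _ Ez] := @compact_nested _ _ (F x)
      (fun i => [set y j | j in [set j | (i <= j)%N]]) (@cF x).
  - by move=> _ [k jk <-]; exists k => //=; exact: leq_trans jk.
  - by have [] := yP m.
  - by exists (y i), i => /=.
  have r6 : 0 < r n / 6 by rewrite divr_gt0.
  have /closure_mdistP/(_ _ r6)[_ [i _ <-] zi] := Ez 0%N.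
  have /closure_mdistP/(_ _ r6)[_ [j /= ij <-] zj] := Ez i.+1.
  have [_ /UP[u [Yu pu ui]]] := yP i; have [_ /UP[v [Yv pv vj]]] := yP j.
  have : r n <= mdist u v.
    apply: p_sep => //; rewrite pu pv => aij.
    by move: ij; rewrite (ainj _ _ aij) ltnn.
  apply/negP; rewrite -ltNge.
  have := metric_triangle u (y i) v; have := metric_triangle (y i) z v.
  have := metric_triangle z (y j) v.
  rewrite (metric_sym (y i) z) (metric_sym (y j) v); lra.
have /choice[B BP] := fun n => indivisible_cover pmu (finG n) (mG n).
have [en enP] := countType_enum (nat * nat)%type.
pose C i := if en i is Some (n, j) then closure (Yn n `&` p @^-1` (B n j)) else set0.
exists C; split.
- move=> i; rewrite /C; case: (en i) => [[n j]|]; first exact: closed_closure.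
  exact: closed0.
- apply: (@negligibleS _ _ _ _ (\bigcup_n hit (G n) (~` \bigcup_j B n j))).
    move=> x /existsNP[y /not_implyP[Fy Cy]].
    have [n yn] : exists n, Yn n y.
      have e0 : 0 < eps - mdist y (p y) by rewrite subr_gt0.
      have [n _ nP] := near_infty_natSinv_lt (PosNum e0); exists n.
      have {nP} : r n < eps - mdist y (p y) := nP n (leqnn n).
      rewrite /Yn/=; lra.
    exists n => //; exists (p y); split.
      by exists y; split => //; exact: UY.
    move=> [j _ Bj]; apply: Cy; have [i ei] := enP (n, j); exists i => //.
    by rewrite /C ei; apply: subset_closure.
  by apply: negligible_bigcup => n; have [] := BP n.
- move=> i D; rewrite /C; case: (en i) => [[n j]|]; last first.
    apply: (@negligibleS _ _ _ _ set0); last exact: negligible_set0.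
    by move=> x [[z [[]]]].
  (* [T] is the set of the indices in [B n j] of the small sets meeting [D]. *)
  pose T := [set a | B n j a /\ (U n [set a] `&` D) !=set0].
  have TB : T `<=` B n j by move=> a [].
  have [T0|T0] := (BP n).1 j T TB.
    apply: negligibleS T0 => x [[z [[Fz Cz] Dz]] _].
    have [b Bb Ub] := U1 _ _ _ (clU _ _ _ Cz).
    by exists b; split; [exists z|split => //; exists z].
  apply: negligibleS T0 => x [_ [w [Fw Cw] wD]].
  have [b Bb Ub] := U1 _ _ _ (clU _ _ _ Cw).
  exists b; split; first by exists w.
  split => // -[_ [z [/UP[v [Yv pv vz]] /wD]]]; apply/negP; rewrite -ltNge.
  have [u [Yu pu uw]] := UP _ _ _ Ub.
  have := metric_triangle w u z; have := metric_triangle u b z.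
  have := metric_triangle b v z.
  rewrite (metric_sym w u) (metric_sym b v).
  have := p_near u; have := p_near v; rewrite pu pv.
  move: Yv (r0 n); rewrite /Yn/= pv; have := mdist_ge0 v b; lra.
Qed.

Hypothesis mu_complete : measure_is_complete mu.
Hypothesis F0 : forall x, F x !=set0.

(** * Measurable selectors *)

Lemma compact_valued_selector : exists f : X -> Y, topmeasurable f /\ selector F f.
Proof.
pose eps k : R := k.+1%:R^-1.
have eps0 k : 0 < eps k by rewrite invr_gt0.
have /choice[C CP] := fun k => small_closed_cover (eps0 k).
(* [Fk k.+1 x] is the part of [Fk k x] in the first [C k i] which it meets, and
   is empty when it meets none. *)
pose Fk := fix Fk k x := if k is k'.+1 then
  [set y | Fk k' x y /\ exists2 i, C k' i y &
     forall j, (j < i)%N -> ~ ((Fk k' x `&` C k' j) !=set0)] else F x.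
have mFk k D : closed D -> measurable (hit (Fk k) D).
  elim: k D => [|k IH] D cD; first exact: hit_closed_measurable.
  have -> : hit (Fk k.+1) D = \bigcup_i (hit (Fk k) (C k i `&` D) `\`
      \bigcup_(j in `I_i) hit (Fk k) (C k j)).
    apply/seteqP; split => x.
      move=> [y [[Fy [i Ci min_i]] Dy]]; exists i => //; split; first by exists y.
      by move=> [j /= ji]; exact: min_i.
    move=> [i _ [[y [Fy [Ci Dy]]] min_i]]; exists y; split => //; split => //.
    by exists i => // j ji Cj; apply: min_i; exists j.
  have [clC _ _] := CP k.
  apply: bigcupT_measurable => i; apply: measurableD.
    by apply: IH; exact: closedI.
  by apply: bigcup_measurable => j _; exact: IH.
(* The exceptional points, where some family [C k] fails to cover [F x]. *)
pose Bad := \bigcup_k [set x | ~ F x `<=` \bigcup_i C k i].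
have Bad0 : mu.-negligible Bad.
  by apply: negligible_bigcup => k; have [] := CP k.
have FkF k x : Fk k x `<=` F x.
  by elim: k => [//|k IH] y [/IH].
have Fk_step k x : ~ Bad x -> Fk k x !=set0 ->
    exists i, Fk k x `&` C k i !=set0 /\ Fk k.+1 x = Fk k x `&` C k i.
  move=> gx [y Fy].
  have exi : exists i, `[< (Fk k x `&` C k i) !=set0 >].
    have [i _ Ci] : (\bigcup_i C k i) y.
      apply: contrapT => nC; apply: gx; exists k => // FC; apply: nC.
      by apply: FC; exact: FkF Fy.
    by exists i; apply/asboolP; exists y.
  case: (ex_minnP exi) => i /asboolP Ci min_i; exists i; split => //.
  apply/seteqP; split => z.
    move=> [Fz [j Cj min_j]]; split => //.
    have [ij|ji|->//] := ltngtP i j; first by case: (min_j i ij).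
    suff : (i <= j)%N by rewrite leqNgt ji.
    by apply: min_i; apply/asboolP; exists z.
  move=> [Fz Cz]; split => //; exists i => // j ji Cj.
  suff : (i <= j)%N by rewrite leqNgt ji.
  by apply: min_i; apply/asboolP.
have FkP x k : ~ Bad x -> closed (Fk k x) /\ Fk k x !=set0.
  move=> gx; elim: k => [|k [clk nek]].
    by split; [apply: compact_closed => //; exact: metric_hausdorff|exact: F0].
  have [i [ne ->]] := Fk_step _ _ gx nek; split => //.
  by apply: closedI => //; have [] := CP k.
have /choice[f fP] : forall x, exists y, F x y /\ (~ Bad x -> forall k, Fk k x y).
  move=> x; have [bx|gx] := pselect (Bad x).
    by have [y Fy] := @F0 x; exists y.
  have [n m nm|n|n|y Fy Ey] := @compact_nested _ _ (F x) (Fk ^~ x) (@cF x).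
  - by rewrite -(subnK nm); elim: (m - n)%N => [//|k IH] y [/IH].
  - exact: FkF.
  - by have [] := FkP x n gx.
  by exists y; split => // _ k; have [clk _] := FkP x k gx; exact: clk.
exists f; split; last by move=> x; have [] := fP x.
suff mf D : closed D -> measurable (f @^-1` D).
  move=> U oU; rewrite -[U]setCK preimage_setC; apply: measurableC.
  exact: mf (open_closedC oU).
move=> clD; pose P := \bigcap_k hit (Fk k) D.
have mP : measurable P by apply: bigcapT_measurable => k; exact: mFk.
pose N k i := [set x | (F x `&` C k i `&` D) !=set0 /\
  exists2 w, (F x `&` C k i) w & forall z, D z -> 4 * eps k <= mdist w z].
have N0 : mu.-negligible (Bad `|` \bigcup_k \bigcup_i N k i).
  apply: negligibleU => //; apply: negligible_bigcup => k.
  by apply: negligible_bigcup => i; have [_ _] := CP k; apply.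
have PN : P `\` f @^-1` D `<=` Bad `|` \bigcup_k \bigcup_i N k i.
  move=> x [Px nDf]; apply: contrapT => /not_orP[gx nN]; apply: nDf.
  apply: clD; apply/closure_mdistP => e e0.
  have [k ke] : exists k, 4 * eps k < e.
    have e40 : 0 < e / 4 by rewrite divr_gt0.
    have [k _ kP] := near_infty_natSinv_lt (PosNum e40); exists k.
    have {kP} : eps k < e / 4 := kP k (leqnn k); lra.
  have [clk nek] := FkP x k gx.
  have [i [_ FkE]] := Fk_step _ _ gx nek.
  have [Ff Fkf] := fP x.
  have [z [Fz Dz]] := Px k.+1 I; rewrite FkE in Fz; case: Fz => Fz Cz.
  have := Fkf gx k.+1; rewrite FkE => -[_ Cf].
  apply: contrapT => far; apply: nN; exists k => //; exists i => //; split.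
    by exists z; split => //; split => //; exact: FkF Fz.
  exists (f x) => // w Dw; rewrite leNgt; apply/negP => fw.
  by apply: far; exists w => //; exact: lt_trans ke.
have -> : f @^-1` D = (P `\` (P `\` f @^-1` D)) `|` (f @^-1` D `\` P).
  apply/seteqP; split => [x fx|x [[Px nPf]|[]//]].
    by have [Px|nPx] := pselect (P x); [left; split => // -[]|right].
  by apply: contrapT => nf; apply: nPf.
apply: measurableU.
  apply: measurableD => //; apply: mu_complete; exact: negligibleS N0.
apply: mu_complete; apply: negligibleS Bad0 => x [Dfx nPx].
apply: contrapT => gx; apply: nPx => k _.
by exists (f x); split => //; have [_] := fP x; apply.
Qed.

End multifunction.

Theorem theorem4 (R : realType) (d : measure_display) (X : measurableType d)
    (mu : {finite_measure set X -> \bar R})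
    (mu_complete : measure_is_complete mu) (mu_perfect : perfect_measure mu)
    (Y : metricType R) (F : X -> set Y)
    (F_nonempty : forall x : X, F x !=set0)
    (F_compact : forall x : X, compact (F x))
    (F_lower : lower_measurable F) :
  exists f : X -> Y, topmeasurable f /\ selector F f.
Proof.
exact: (compact_valued_selector F_compact F_lower mu_perfect mu_complete
  F_nonempty).
Qed.
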